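(* Let $k \geq 2$ be an integer and let $G$ be a $k$-connected graph of order $n$. If $\chi(G) \geq n - k$, then either $G$ is Hamiltonian, or $n \geq 2k + 1$ and $G$ is (isomorphic to) the graph $K_k \vee (K_k^c \cup K_{n-2k})$.
   Context: All graphs are finite and undirected, without loops or multiple edges. The order of a graph is its number of vertices. $\chi(G)$ denotes the chromatic number of $G$. $K_m$ denotes the complete graph on $m$ vertices, and $G^c$ denotes the complement of $G$ (so $K_k^c$ is the graph with $k$ vertices and no edges). $G \cup H$ denotes the disjoint union of two graphs with disjoint vertex sets, and $G \vee H$ denotes the join of two disjoint graphs $G$ and $H$, i.e. the graph obtained from their disjoint union by adding all edges between vertices of $G$ and vertices of $H$. A graph is $k$-connected if it has more than $k$ vertices and remains connected after deletion of any set of fewer than $k$ vertices. A graph is Hamiltonian if it has a Hamiltonian cycle, i.e. a cycle containing all of its vertices. *)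

(* Defs.v *)
From mathcomp Require Import all_boot.

Set Implicit Arguments.
Unset Strict Implicit.
Unset Printing Implicit Defensive.

Record sgraph := SGraph {
  vertex :> finType;
  adj : rel vertex;
  adj_sym : symmetric adj;
  adj_irrefl : irreflexive adj }.

Definition sgraph_iso (G H : sgraph) : Prop :=
  exists2 f : G -> H, bijective f & forall x y, adj (f x) (f y) = adj x y.

Section Complete.
Variable m : nat.
Definition complete_rel : rel 'I_m := fun x y => x != y.
Lemma complete_sym : symmetric complete_rel.
Proof. by move=> x y; rewrite /complete_rel eq_sym. Qed.
Lemma complete_irrefl : irreflexive complete_rel.
Proof. by move=> x; rewrite /complete_rel eqxx. Qed.
Definition complete := SGraph complete_sym complete_irrefl.
End Complete.

Section Complement.
Variable G : sgraph.
Definition complement_rel : rel G := fun x y => (x != y) && ~~ adj x y.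
Lemma complement_sym : symmetric complement_rel.
Proof. by move=> x y; rewrite /complement_rel eq_sym adj_sym. Qed.
Lemma complement_irrefl : irreflexive complement_rel.
Proof. by move=> x; rewrite /complement_rel eqxx. Qed.
Definition complement := SGraph complement_sym complement_irrefl.
End Complement.

(* [b] is the adjacency between the two parts: [false] gives the disjoint
   union, [true] the join. *)
Section Sum.
Variables (b : bool) (G H : sgraph).
Definition sum_rel : rel (G + H)%type := fun u v =>
  match u, v with
  | inl x, inl y => adj x y
  | inr x, inr y => adj x y
  | _, _ => b
  end.
Lemma sum_sym : symmetric sum_rel.
Proof. by move=> [x|x] [y|y] //=; rewrite adj_sym. Qed.
Lemma sum_irrefl : irreflexive sum_rel.
Proof. by move=> [x|x] /=; rewrite adj_irrefl. Qed.
Definition sum_graph := SGraph sum_sym sum_irrefl.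
End Sum.

Definition disjoint_union := sum_graph false.
Definition join := sum_graph true.

Section Delete.
Variables (G : sgraph) (S : {set G}).
Definition delete_rel : rel {x : G | x \notin S} :=
  fun u v => adj (val u) (val v).
Lemma delete_sym : symmetric delete_rel.
Proof. by move=> u v; rewrite /delete_rel adj_sym. Qed.
Lemma delete_irrefl : irreflexive delete_rel.
Proof. by move=> u; rewrite /delete_rel adj_irrefl. Qed.
Definition delete := SGraph delete_sym delete_irrefl.
End Delete.

(* The empty graph counts as connected; this case never arises in [kconnected],
   where fewer than k of more than k vertices are deleted. *)
Definition connected (G : sgraph) : Prop :=
  forall x y : G, connect (@adj G) x y.

Definition kconnected (k : nat) (G : sgraph) : Prop :=
  k < #|G| /\ forall S : {set G}, #|S| < k -> connected (delete S).

(* The size condition excludes the degenerate closed walk [:: x; y] along a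
   single edge, which [ucycle] accepts. *)
Definition hamiltonian (G : sgraph) : Prop :=
  exists c : seq G,
    [/\ 3 <= size c, ucycle (@adj G) c & forall x : G, x \in c].

Definition colorable (G : sgraph) (m : nat) : bool :=
  [exists f : {ffun G -> 'I_m},
     [forall x, [forall y, adj x y ==> (f x != f y)]]].

Lemma ex_colorable (G : sgraph) : exists m, colorable G m.
Proof.
exists #|G|; apply/existsP; exists [ffun x => enum_rank x].
apply/forallP => x; apply/forallP => y; apply/implyP => xy; rewrite !ffunE.
by apply: contraTneq xy => /enum_rank_inj ->; rewrite adj_irrefl.
Qed.

Definition chromatic_number (G : sgraph) : nat := ex_minn (ex_colorable G).

(* Main.v *)
Require Import Defs.
From mathcomp Require Import all_boot zify.

(* Let G be non-Hamiltonian and let G+ be an edge-maximal non-Hamiltonian graph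
   on V(G) containing G.  Nonadjacent vertices of G+ are joined by a Hamiltonian
   path, so by Ore's argument their degrees in G+ add up to at most n - 1.  Take
   nonadjacent u, v maximizing d+(u) + d+(v), with h = d+(u) <= d+(v).  At least
   h vertices are nonadjacent to v, and by maximality their degrees are at most
   h < n - h.  Let L be h of them: colouring V \ L injectively and then L greedily
   shows chi(G) <= n - h, so that h <= k, while k <= h by k-connectedness.  Hence
   |L| = k and the vertices of L have degree exactly k, in G as well as in G+.

   If n >= 2k + 2, the same colouring saves one more colour unless C = V \ L is a
   clique of G.  A vertex of C with a neighbour in L has degree at least n - k,
   hence is joined to all of L by Ore's condition.  The set T of these vertices
   separates L from v, so |T| >= k, which forces N(l) = T for every l in L.

   If n = 2k + 1, then G+ has minimum degree at least (n - 1) / 2, and a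
   Nash-Williams type argument along a Hamiltonian path gives a cut vertex, which
   is excluded, or an independent set S of k + 1 vertices.  Every vertex of S is
   then adjacent to all of V \ S, and V \ S is a clique since otherwise G would
   be k-colourable. *)

Set Implicit Arguments.
Unset Strict Implicit.
Unset Printing Implicit Defensive.

(** * Hamiltonian paths in a non-Hamiltonian graph *)

Section Graph.
Variables (V : finType) (e : rel V).
Hypotheses (e_sym : symmetric e) (e_irr : irreflexive e).

(** Stated for a bare relation, so that edges can be added on a fixed vertex set, and boolean, so
    that maximality can be decided by cases. *)
Definition ham : bool :=
  (2 < #|V|) && [exists t : #|V|.-tuple V, ucycleb e t].

Definition ham_path (s : seq V) :=
  [&& size s == #|V|, uniq s & sorted e s].

Definition deg (x : V) := #|[set y | e x y]|.

Lemma hamP (c : seq V) :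
  2 < #|V| -> size c = #|V| -> uniq c -> cycle e c -> ham.
Proof.
move=> V_gt2 /eqP sz_c Uc Cc; rewrite /ham V_gt2 /=; apply/existsP.
by exists (Tuple sz_c); apply/andP.
Qed.

Lemma uniq_full (s : seq V) : size s = #|V| -> uniq s -> s =i predT.
Proof.
move=> sz_s Us; apply/subset_cardP; last exact/subset_predT.
by rewrite (card_uniqP Us).
Qed.

Lemma deg_count (s : seq V) x :
  size s = #|V| -> uniq s -> deg x = count (e x) s.
Proof.
move=> sz_s Us; rewrite /deg -size_filter.
rewrite -(card_uniqP (filter_uniq _ Us)).
by apply: eq_card => y; rewrite inE mem_filter uniq_full ?andbT.
Qed.

Lemma sorted_catE x0 (s t : seq V) : s != [::] -> t != [::] ->
  sorted e (s ++ t) = [&& sorted e s, e (last x0 s) (head x0 t) & sorted e t].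
Proof. by case: s t => [|x s] [|y t] // _ _ /=; rewrite cat_path. Qed.

Lemma sorted_rev s : sorted e (rev s) = sorted e s.
Proof. by rewrite rev_sorted; apply: eq_sorted => x y; rewrite e_sym. Qed.

Lemma head_rev_last x0 (s : seq V) : head x0 (rev s) = last x0 s.
Proof. by case/lastP: s => //= s x; rewrite rev_rcons last_rcons. Qed.

Lemma last_rev_head x0 (s : seq V) : last x0 (rev s) = head x0 s.
Proof. by rewrite -head_rev_last revK. Qed.

Lemma cycleE x0 (s : seq V) : s != [::] ->
  cycle e s = sorted e s && e (last x0 s) (head x0 s).
Proof. by case: s => //= x s _; rewrite rcons_path. Qed.

Hypotheses (V_gt2 : 2 < #|V|) (nonham : ~~ ham).

Lemma ham_path_neq0 s : ham_path s -> s != [::].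
Proof. by case/and3P=> /eqP; case: s => //= V0; move: V_gt2; rewrite -V0. Qed.

Lemma ham_path_ends x0 s : ham_path s -> ~~ e (last x0 s) (head x0 s).
Proof.
move=> hs; apply/negP => ee; case/negP: nonham.
have s0 := ham_path_neq0 hs; case/and3P: hs => /eqP sz Us ss.
by apply: (@hamP s) => //; rewrite (cycleE x0) // ss.
Qed.

(** Traversing [s] and then [t] backwards uses one of the two edges as a link, and the other one
    closes this path to a Hamiltonian cycle. *)
Lemma ham_path_cross x0 s t : ham_path (s ++ t) -> s != [::] -> t != [::] ->
  e (head x0 s) (head x0 t) -> e (last x0 s) (last x0 t) -> False.
Proof.
move=> /and3P[/eqP sz Us]; move=> ss s0 t0.
move: ss; rewrite (sorted_catE x0) // => /and3P[ss st tt] e1 e2.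
have rt0 : rev t != [::] by rewrite -size_eq0 size_rev size_eq0.
have hp : ham_path (s ++ rev t).
  apply/and3P; split.
  - by rewrite size_cat size_rev -size_cat sz.
  - by rewrite (perm_uniq (s2 := s ++ t)) // perm_cat2l perm_rev.
  - by rewrite (sorted_catE x0) // sorted_rev head_rev_last ss e2 tt.
have := ham_path_ends x0 hp; rewrite last_cat.
have -> : last (last x0 s) (rev t) = last x0 (rev t).
  by case: (rev t) rt0.
have -> : head x0 (s ++ rev t) = head x0 s by case: (s) s0.
by rewrite last_rev_head e_sym e1.
Qed.

(** Pósa rotation: the given edge replaces the link between [s] and [t], and the former end of [s]
    becomes the first vertex of the path. *)
Lemma ham_path_rotate x0 s t : ham_path (s ++ t) -> s != [::] -> t != [::] ->
  e (head x0 s) (head x0 t) -> ham_path (rev s ++ t).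
Proof.
move=> /and3P[/eqP sz Us ss] s0 t0 e1.
have rs0 : rev s != [::] by rewrite -size_eq0 size_rev size_eq0.
move: ss; rewrite (sorted_catE x0) // => /and3P[ss st tt].
apply/and3P; split.
- by rewrite size_cat size_rev -size_cat sz.
- by rewrite (perm_uniq (s2 := s ++ t)) // perm_cat2r perm_rev.
- by rewrite (sorted_catE x0) // sorted_rev last_rev_head ss e1 tt.
Qed.

Lemma take_drop_cross x0 p i : ham_path p -> 0 < i < #|V| ->
  e (nth x0 p 0) (nth x0 p i) -> e (nth x0 p i.-1) (nth x0 p #|V|.-1) -> False.
Proof.
move=> hp /andP[i0 iV] e1 e2; have /eqP sz : size p == #|V| by case/and3P: hp.
apply: (@ham_path_cross x0 (take i p) (drop i p)); rewrite ?cat_take_drop //.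
- by rewrite -size_eq0 size_take sz iV -lt0n.
- by rewrite -size_eq0 size_drop sz -lt0n subn_gt0.
- by rewrite -!nth0 nth_take // nth_drop addn0.
- rewrite -!nth_last size_take size_drop sz iV nth_take ?nth_drop; last by lia.
  by have -> : i + (#|V| - i).-1 = #|V|.-1 by lia.
Qed.

Lemma deg_nth x0 p x : ham_path p ->
  deg x = \sum_(0 <= i < #|V|) e x (nth x0 p i).
Proof.
case/and3P=> /eqP sz Us _; rewrite (deg_count x sz Us) -sz.
by rewrite -sum1_count (big_nth x0) big_mkcond /=; apply: eq_bigr => i _; case: e.
Qed.

(** The second degree is summed with its index shifted by one, so that each summand pairs the two
    edges that [take_drop_cross] forbids to coexist. *)
Lemma deg_ends x0 p : ham_path p ->
  deg (nth x0 p 0) + deg (nth x0 p #|V|.-1) =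
  \sum_(1 <= i < #|V|)
    (e (nth x0 p 0) (nth x0 p i) + e (nth x0 p i.-1) (nth x0 p #|V|.-1)).
Proof.
move=> hp; rewrite !(deg_nth x0 _ hp) big_split /=; congr (_ + _).
  by rewrite big_ltn ?e_irr ?add0n //; apply: ltn_trans V_gt2.
have -> : #|V| = #|V|.-1.+1 by rewrite prednK //; apply: ltn_trans V_gt2.
rewrite /= big_nat_recr //= e_irr addn0 big_add1 /=.
by apply: eq_bigr => i _; rewrite e_sym.
Qed.

Lemma ore x0 p : ham_path p ->
  deg (nth x0 p 0) + deg (nth x0 p #|V|.-1) <= #|V|.-1.
Proof.
move=> hp; rewrite deg_ends //.
apply: (@leq_trans (\sum_(1 <= i < #|V|) 1)); last by rewrite sum_nat_const_nat; lia.
rewrite big_nat_cond [leqRHS]big_nat_cond; apply: leq_sum => i; rewrite andbT => hi.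
case e1: (e _ _); case e2: (e _ _) => //.
by case: (@take_drop_cross x0 p i).
Qed.

(** In [deg_ends] there are n - 1 summands, each at most 1; if their sum reaches n - 1, none of them
    vanishes. *)
Lemma ore_tight x0 p i : ham_path p -> 0 < i < #|V| ->
  #|V|.-1 <= deg (nth x0 p 0) + deg (nth x0 p #|V|.-1) ->
  ~~ e (nth x0 p 0) (nth x0 p i) -> e (nth x0 p i.-1) (nth x0 p #|V|.-1).
Proof.
move=> hp hi; rewrite deg_ends // => le /negbTE e1; apply/negPn/negP => /negbTE e2.
move: le; rewrite leqNgt => /negP; apply.
have hi' : i \in index_iota 1 #|V| by rewrite mem_index_iota.
rewrite (bigD1_seq i) ?iota_uniq //= e1 e2 !add0n.
apply: (@leq_ltn_trans (\sum_(1 <= i0 < #|V| | i0 != i) 1)).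
  rewrite big_nat_cond [leqRHS]big_nat_cond; apply: leq_sum => j /andP[hj _].
  case e3: (e _ _); case e4: (e _ _) => //.
  by case: (@take_drop_cross x0 p j).
have : \sum_(1 <= i0 < #|V|) 1 = #|V|.-1 by rewrite sum_nat_const_nat; lia.
by rewrite (bigD1_seq i) ?iota_uniq //=; lia.
Qed.

(* The set consists of [x] and the successors on [c] of the neighbours of [x]. *)
Lemma cycle_missing_indep c x : uniq (x :: c) -> size (x :: c) = #|V| ->
  cycle e c ->
  exists2 S : {set V}, #|S| = (deg x).+1 & {in S &, forall a b, ~~ e a b}.
Proof.
move=> U sz Cc; set N := [set y | e x y].
have Uc : uniq c by case/andP: U.
have xc : x \notin c by case/andP: U.
have full := uniq_full sz U.
have Nc y : y \in N -> y \in c.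
  rewrite inE => xy; have := full y; rewrite !inE => /orP[/eqP yx|//].
  by rewrite yx e_irr in xy.
have nextx y : y \in N -> ~~ e x (next c y).
  move=> yN; have yc := Nc _ yN; have [i s Ec] := rot_to yc.
  have Us : uniq (y :: s) by rewrite -Ec rot_uniq.
  have Cs : cycle e (y :: s) by rewrite -Ec rot_cycle.
  have -> : next c y = head y s by rewrite -(next_rot i) // Ec /=; case: (s) => [|z t] /=; rewrite ?eqxx.
  (* Go round the cycle from the successor of [y] to [y], then to [x]; an edge from [x] to that
     successor would close this path. *)
  have hp : ham_path (rcons (rcons s y) x).
    apply/and3P; split.
    - by rewrite !size_rcons -sz /= -(size_rot i c) Ec.
    - rewrite (perm_uniq (s2 := x :: y :: s)).
        by rewrite cons_uniq Us andbT -Ec mem_rot.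
      by apply/permP => a; rewrite -!cats1 !count_cat /=; clear; lia.
    - move: Cs => /= Cs; case: (s) Cs => [|z t] /=.
        by rewrite e_irr.
      case/andP=> _ h; rewrite rcons_path last_rcons h /=.
      by move: yN; rewrite inE e_sym.
  have := ham_path_ends y hp; rewrite last_rcons.
  by case: (s) => //=.
exists (x |: [set next c y | y in N]).
  rewrite cardsU1 card_in_imset; last first.
    by move=> y z _ _ /(can_inj (prev_next Uc)).
  rewrite -/(deg x) -add1n; congr (_ + _).
  case: imsetP => // -[y yN xE]; move: xc; rewrite xE mem_next.
  by rewrite Nc.
have cross y z : y \in N -> z \in N -> y != z -> ~~ e (next c y) (next c z).
  move=> yN zN yz; have yc := Nc _ yN; have zc := Nc _ zN.
  have [i s Ec] := rot_to yc.
  have Us : uniq (y :: s) by rewrite -Ec rot_uniq.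
  have Cs : cycle e (y :: s) by rewrite -Ec rot_cycle.
  have : z \in y :: s by rewrite -Ec mem_rot.
  rewrite inE eq_sym (negbTE yz) /= => zs.
  rewrite -!(next_rot i Uc) Ec.
  case/splitPr: zs Ec Us Cs => s1 s2 Ec Us Cs.
  have -> : next (y :: s1 ++ z :: s2) y = head y (rcons s1 z).
    by rewrite /=; case: (s1) => [|a t] /=; rewrite eqxx.
  (* The default [y] matters: for empty [s2] the cycle returns from [z] to [y]. *)
  have -> : next (y :: s1 ++ z :: s2) z = head y s2.
    rewrite next_nth inE mem_cat !inE eqxx !orbT.
    have zs1 : z \notin y :: s1.
      move: Us; rewrite -cat_cons cat_uniq => /and3P[_ /hasPn/(_ z)].
      by rewrite inE eqxx => /(_ isT).
    have -> : index z (y :: s1 ++ z :: s2) = (size s1).+1.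
      by rewrite -cat_cons index_cat (negbTE zs1) /= eqxx addn0.
    by rewrite nth_cat ltnNge leqnSn /= subSnn /= nth0.
  (* From the successor of [y] forward to [z], through [x] to [y], then backward to the successor of
     [z]: the two successors are the ends of a Hamiltonian path. *)
  have hp : ham_path (rcons s1 z ++ x :: y :: rev s2).
    apply/and3P; split.
    - rewrite size_cat size_rcons /= size_rev -sz /= -(size_rot i c) Ec /= size_cat /=.
      by rewrite addSn !addnS.
    - rewrite (perm_uniq (s2 := x :: y :: s1 ++ z :: s2)).
        by rewrite cons_uniq Us andbT -Ec mem_rot.
      apply/permP => a; rewrite count_cat -cats1 !count_cat /= count_rev count_cat /=.
      by clear; lia.
    - rewrite (sorted_catE x) ?last_rcons //; last by case: (s1).
      move: Cs; rewrite /= rcons_cat cat_path /= rcons_path => /and4P[p1 l1 p2 l2].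
      move: yN zN; rewrite !inE => xy xz.
      rewrite xy e_sym xz /=; apply/andP; split.
        by have : path e y (rcons s1 z) by [rewrite rcons_path p1]; apply: path_sorted.
      have := rev_path e y (rcons s2 y).
      have : path e z (rcons s2 y) by rewrite rcons_path p2.
      move/path_sorted; rewrite -sorted_rev rev_rcons //=.
  have := ham_path_ends y hp; rewrite last_cat /= last_rev_head e_sym.
  by case: (s1).
move=> a b /setU1P[->|/imsetP[y yN ->]] /setU1P[->|/imsetP[z zN ->]].
- by rewrite e_irr.
- exact: nextx.
- by rewrite e_sym nextx.
- by case: (eqVneq y z) => [->|]; [rewrite e_irr | exact: cross].
Qed.

(* Write p = p_0 ... p_2k.  As all degrees are at least k, for each i exactly one
   of p_0 ~ p_i and p_(i-1) ~ p_2k holds.  If some p_i is not adjacent to p_0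
   while p_(i+1) is, there is a cycle missing only p_i.  Otherwise p_0 is adjacent
   exactly to p_1, ..., p_k, and no edge joins the vertices before p_k to those
   after it. *)
Lemma indep_or_cutvertex k (x0 : V) p : #|V| = k.*2.+1 -> (forall x, k <= deg x) ->
  ham_path p ->
  (exists2 S : {set V}, k < #|S| & {in S &, forall a b, ~~ e a b}) \/
  (exists A : {set V}, exists c x y,
     [/\ x \in A, y \notin A, x != c, y != c &
         forall a b, a \in A -> a != c -> e a b -> b != c -> b \in A]).
Proof.
move=> Vk deg_k hp.
have /and3P[/eqP sz Up sp] := hp.
have k_gt0 : 0 < k by move: V_gt2; rewrite Vk; clear; case: k.
pose q i := nth x0 p i.
have sizep : size p = k.*2.+1 by rewrite sz.
(* Two degrees of at least k already reach n - 1 = 2k, so Ore's bound is attained and both ends have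
   degree k. *)
have tight : #|V|.-1 <= deg (nth x0 p 0) + deg (nth x0 p #|V|.-1).
  by rewrite Vk /= -addnn leq_add.
have deg0 : deg (q 0) = k.
  have := ore x0 hp; have := deg_k (q 0); have := deg_k (nth x0 p #|V|.-1).
  by rewrite Vk /= -addnn -/(q 0); clear; lia.
case: (boolP [exists i : 'I_k.*2, [&& 0 < i, ~~ e (q 0) (q i) & e (q 0) (q i.+1)]]).
  case/existsP=> -[i ik] /= /and3P[i0 n1 e1]; left.
  have n2 : e (q i.-1) (q k.*2).
    by have := @ore_tight x0 p i hp; rewrite tight Vk /= i0 ltnS (ltnW ik) //; apply.
  have pE : p = take i p ++ q i :: drop i.+1 p.
    by rewrite -drop_nth ?cat_take_drop // sizep ltnS (ltnW ik).
  have t0 : take i p != [::].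
    by rewrite -size_eq0 size_take sizep ltnS (ltnW ik) // -lt0n.
  have d0 : drop i.+1 p != [::].
    by rewrite -size_eq0 size_drop sizep subSS subn_eq0 -ltnNge.
  have rd0 : rev (drop i.+1 p) != [::] by rewrite -size_eq0 size_rev size_eq0.
  have perm : perm_eq (q i :: take i p ++ rev (drop i.+1 p)) p.
    apply/permP => a; rewrite [in RHS]pE /= !count_cat count_rev /=; clear; lia.
  (* The cycle is p_0, ..., p_(i-1), p_2k, ..., p_(i+1), closed by the edge from p_(i+1) to p_0. *)
  case: (@cycle_missing_indep (take i p ++ rev (drop i.+1 p)) (q i)).
  - by rewrite (perm_uniq perm).
  - by rewrite (perm_size perm).
  - rewrite (cycleE x0) ?(sorted_catE x0) //; last first.
      by rewrite -size_eq0 size_cat addn_eq0 size_eq0 (negbTE t0).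
    rewrite sorted_rev take_sorted // drop_sorted // head_rev_last last_cat.
    have -> : last (last x0 (take i p)) (rev (drop i.+1 p)) = q i.+1.
      have -> : last (last x0 (take i p)) (rev (drop i.+1 p)) =
                last x0 (rev (drop i.+1 p)) by case: (rev _) rd0.
      by rewrite last_rev_head -nth0 nth_drop addn0.
    have -> : head x0 (take i p ++ rev (drop i.+1 p)) = q 0.
      by rewrite -nth0 nth_cat size_take sizep ltnS (ltnW ik) // i0 nth_take.
    rewrite -!nth_last size_take size_drop sizep ltnS (ltnW ik) // nth_take; last first.
      by rewrite prednK.
    rewrite nth_drop.
    have -> : i.+1 + (k.*2.+1 - i.+1).-1 = k.*2 by move: ik; clear; lia.
    by rewrite -/(q _) -/(q _) n2 e_sym e1.
  move=> S cardS indS; exists S => //.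
  by rewrite cardS ltnS.
rewrite negb_exists => /forallP nogap; right.
have down i : 0 < i -> i < k.*2 -> e (q 0) (q i.+1) -> e (q 0) (q i).
  move=> i0 ik e1; have := nogap (Ordinal ik); rewrite /= i0 e1 andbT.
  by rewrite negbK.
have downs i j : 0 < i -> i <= j -> j <= k.*2 -> e (q 0) (q j) -> e (q 0) (q i).
  move=> i0; elim: j => [|j IH]; first by move: i0; clear; lia.
  rewrite leq_eqVlt => /orP[/eqP -> //|ij] jk e1.
  by apply: IH (ltnW jk) (down j (leq_trans i0 ij) jk e1).
have degE : \sum_(0 <= i < k.*2.+1) e (q 0) (q i) = k.
  by rewrite -[RHS]deg0 (deg_nth x0 _ hp) Vk.
(* By [downs], a neighbour p_i of p_0 makes all of p_1, ..., p_i neighbours, which is too many for i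
   > k. *)
have up i : k < i -> i <= k.*2 -> ~~ e (q 0) (q i).
  move=> ki ik; apply/negP => e1.
  suff : i <= k by rewrite leqNgt ki.
  rewrite -degE (@big_cat_nat _ _ _ i.+1) //=.
  apply: leq_trans (leq_addr _ _); rewrite big_ltn // e_irr add0n.
  have {1}-> : i = \sum_(1 <= j < i.+1) 1 by rewrite sum_nat_const_nat muln1 subn1.
  rewrite big_nat_cond [leqRHS]big_nat_cond; apply: leq_sum => j.
  by rewrite andbT => /andP[j0 ji]; rewrite (downs j i).
(* By [downs], if p_i is not a neighbour of p_0, then no later vertex is, leaving at most i - 1 < k
   neighbours. *)
have low i : 0 < i -> i <= k -> e (q 0) (q i).
  move=> i0 ik; apply/negPn/negP => e1.
  suff : k <= i.-1 by move: i0 ik; clear; lia.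
  have i2k : i <= k.*2.+1 by move: ik; clear; lia.
  rewrite -{1}degE (@big_cat_nat _ _ _ i) //= [X in _ + X]big1_seq ?addn0.
    rewrite big_ltn // e_irr add0n.
    have -> : i.-1 = \sum_(1 <= j < i) 1 by rewrite sum_nat_const_nat muln1 subn1.
    by apply: leq_sum => j _; case: e.
  move=> j; rewrite mem_index_iota => /andP[_ /andP[ij jk]].
  by case e2: (e _ _) => //; rewrite (downs i j) in e1.
have high j : k <= j -> j < k.*2 -> e (q j) (q k.*2).
  move=> kj jk; have := @ore_tight x0 p j.+1 hp.
  by rewrite tight Vk /= ltnS; apply=> //; apply: up.
have idx x : index x p < k.*2.+1.
  by rewrite -sizep index_mem uniq_full.
have qidx x : q (index x p) = x by rewrite /q nth_index // uniq_full.
have idxq i : i < k.*2.+1 -> index (q i) p = i.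
  by move=> ik; rewrite index_uniq // sizep.
have k2 : k < k.*2.+1 by clear; lia.
exists [set x | index x p < k], (q k), (q 0), (q k.*2); split.
- by rewrite inE idxq.
- by rewrite inE idxq // -leqNgt; clear; lia.
- by apply/eqP => /(congr1 (index^~ p)); rewrite !idxq //; move: k_gt0; clear; lia.
- by apply/eqP => /(congr1 (index^~ p)); rewrite !idxq //; move: k_gt0; clear; lia.
move=> a b; rewrite !inE => ak _ eab bc.
rewrite ltnNge leq_eqVlt; apply/negP => /orP[/eqP kb|kb].
  by case/eqP: bc; rewrite kb qidx.
set i := index a p in ak; set j := index b p in kb.
have jk : j <= k.*2 by rewrite -ltnS idx.
have ik : i.+1 < size p by rewrite sizep; move: ak; clear; lia.
(* Suppose p_i ~ p_j with i < k < j. Since p_0 ~ p_(i+1), rotation gives the path p_i, ..., p_0,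
   p_(i+1), ..., p_2k. There p_i ~ p_j and p_(j-1) ~ p_2k are a forbidden pair. *)
have hp' : ham_path (rev (take i.+1 p) ++ drop i.+1 p).
  apply: (@ham_path_rotate x0); rewrite ?cat_take_drop //.
  - by rewrite -size_eq0 size_take ik.
  - by rewrite -size_eq0 size_drop subn_eq0 -ltnNge.
  - by rewrite -!nth0 nth_take // nth_drop addn0; apply: low.
have nthp' l : i < l -> nth x0 (rev (take i.+1 p) ++ drop i.+1 p) l = q l.
  move=> il; rewrite nth_cat size_rev size_take ik ltnNge il /= nth_drop.
  by rewrite subnKC.
apply: (@take_drop_cross x0 _ j hp').
- by rewrite Vk ltnS jk andbT; move: kb; clear; lia.
- rewrite (nthp' j (ltn_trans ak kb)) nth_cat size_rev size_take ik ltn0Sn.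
  rewrite nth_rev ?size_take ik // subSS subn0 nth_take // -/(q _) /i /j.
  by rewrite !qidx.
- rewrite !nthp' ?Vk /=; try by move: ak kb jk; clear; lia.
  by apply: high; move: kb jk; clear; lia.
Qed.

End Graph.

(** * Edge-maximal non-Hamiltonian graphs *)

Lemma ham_path_rev (V : finType) (e : rel V) s :
  symmetric e -> ham_path e (rev s) = ham_path e s.
Proof. by move=> e_sym; rewrite /ham_path size_rev rev_uniq sorted_rev. Qed.

Definition add_edge (V : finType) (e : rel V) (x y : V) : rel V :=
  fun a b => [|| e a b, (a == x) && (b == y) | (a == y) && (b == x)].

(** A Hamiltonian cycle of the enlarged graph must use the new edge; deleting that edge leaves the
    path. *)
Lemma ham_add_edge (V : finType) (e : rel V) x y :
  symmetric e -> ~~ ham e -> x != y -> ham (add_edge e x y) ->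
  exists p, [/\ ham_path e p, head x p = x & last x p = y].
Proof.
move=> e_sym nh xy /andP[V_gt2 /existsP[t /andP[Ct Ut]]].
have xt : x \in (t : seq V) by rewrite (uniq_full (size_tuple t)).
have [i s Es] := rot_to xt.
have Us : uniq (x :: s) by rewrite -Es rot_uniq.
have : cycle (add_edge e x y) (x :: s) by rewrite -Es rot_cycle.
have sz : size (x :: s) = #|V| by rewrite -Es size_rot size_tuple.
have xs : x \notin s by case/andP: Us.
case: s {Es} Us xs sz => [|z s] Us xs sz; first by rewrite -sz in V_gt2.
rewrite /= rcons_path => /and3P[xz zs sx].
(* The cycle has been rotated to start at [x]; the rest avoids [x], so its edges are old. *)
have es : path e z s.
  have : all (predC1 x) (z :: s) by apply/allP => w ws /=; apply: contraNneq xs => <-.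
  have eP : {in (predC1 x) &, forall a b, add_edge e x y a b = e a b}.
    move=> a b; rewrite !inE /add_edge => /negbTE -> /negbTE ->.
    by rewrite andbF !orbF.
  by move/(eq_in_sorted eP) => /= <-.
have s0 : s != [::] by move: V_gt2; rewrite -sz; case: (s).
have lz : last z s != z.
  have : last z s \in s by case: (s) s0 => //= a s' _; apply: mem_last.
  by move: Us => /= /and3P[_ zs' _] ls; apply: contraNneq zs' => <-.
have zx : z != x by move: xs; rewrite inE negb_or eq_sym => /andP[].
have lx : last z s != x.
  by apply: contraNneq xs => <-; apply: mem_last.
move: xz sx; rewrite /add_edge (negbTE zx) (negbTE lx) eqxx (negbTE xy) /=.
(* Each of the two cycle edges at [x] is old or new. Two old ones give a Hamiltonian cycle of [e],
   and two new ones would make both cycle neighbours of [x] equal to [y]. *)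
rewrite orbF andbT => /orP[xz|/eqP zy] /orP[lxe|].
- case/negP: nh; apply: (@hamP _ e (x :: z :: s)) => //.
  by rewrite /= rcons_path xz es.
- move=> /eqP ly; exists (x :: z :: s); split => //.
  by apply/and3P; split; rewrite ?sz //= xz es.
- exists (rev (rcons (z :: s) x)); split.
  + rewrite ham_path_rev //; apply/and3P; split.
    * by rewrite size_rcons -sz.
    * by rewrite rcons_uniq xs; case/andP: Us.
    * by rewrite /= rcons_path es.
  + by rewrite head_rev_last last_rcons.
  + by rewrite last_rev_head.
- by rewrite -zy (negbTE lz).
Qed.

(** Edges are added as long as no Hamiltonian cycle arises, by induction on the number of
    nonadjacent pairs; at the end [ham_add_edge] supplies the paths. *)
Lemma maximal_nonham (V : finType) (e : rel V) :
  symmetric e -> irreflexive e -> ~~ ham e ->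
  exists e' : rel V, [/\ symmetric e', irreflexive e', subrel e e', ~~ ham e' &
    forall x y, x != y -> ~~ e' x y ->
      exists p, [/\ ham_path e' p, head x p = x & last x p = y]].
Proof.
have [m] := ubnP #|[set q : V * V | ~~ e q.1 q.2]|.
elim: m e => // m IH e; rewrite ltnS => le_m e_sym e_irr nh.
case: (boolP [exists q : V * V,
    [&& q.1 != q.2, ~~ e q.1 q.2 & ~~ ham (add_edge e q.1 q.2)]]).
  case/existsP=> -[x y] /= /and3P[xy nxy nh'].
  case: (IH (add_edge e x y)) => //.
  - apply: leq_trans le_m; apply: proper_card; apply/properP; split.
      by apply/subsetP => -[a b]; rewrite !inE /= negb_or => /andP[].
    by exists (x, y); rewrite !inE //= /add_edge !eqxx orbT.
  - move=> a b; rewrite /add_edge e_sym; congr (_ || _).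
    by rewrite orbC andbC [(b == y) && _]andbC.
  - move=> a; rewrite /add_edge e_irr /=; apply/negP => /orP[] /andP[/eqP ->].
      by rewrite (negbTE xy).
    by rewrite eq_sym (negbTE xy).
  - move=> e' [? ? sub ? ?]; exists e'; split => //.
    by move=> a b ab; apply: sub; rewrite /add_edge ab.
rewrite negb_exists => /forallP max; exists e; split => // x y xy nxy.
apply: ham_add_edge => //.
by have := max (x, y); rewrite /= xy nxy /= negbK.
Qed.

(** * Greedy colouring, and consequences of k-connectedness *)

(** The vertices outside [C] are coloured one at a time, each having too few neighbours to block all
    of [D]. Colours are themselves vertices, so an injective colouring of [C] is just the
    identity. *)
Lemma greedy_coloring (V : finType) (e : rel V) (C D : {set V}) (f : V -> V) :
  symmetric e -> irreflexive e ->
  {in C, forall x, f x \in D} ->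
  {in C &, forall x y, e x y -> f x != f y} ->
  (forall z, z \notin C -> deg e z < #|D|) ->
  exists2 g : V -> V, forall x, g x \in D & forall x y, e x y -> g x != g y.
Proof.
move=> e_sym e_irr; have [m] := ubnP #|~: C|.
elim: m C f => // m IH C f; rewrite ltnS => le_m fD fC degC.
have [CT|[z zC]] := set_0Vmem (~: C).
  have inC x : x \in C by have := in_set0 x; rewrite -CT inE => /negbFE.
  by exists f => [x|x y]; [apply: fD | apply: fC].
have zC' : z \notin C by rewrite inE in zC.
(* The colour also avoids the provisional values of [f] at neighbours outside [C]; the degree bound
   leaves room for this. *)
have [d dD dN] : exists2 d, d \in D & d \notin f @: [set y | e z y].
  apply/subsetPn; apply: contraL (degC z zC') => /subset_leq_card le.
  by rewrite -leqNgt (leq_trans le) // leq_imset_card.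
have dne y : e z y -> f y != d.
  by move=> ezy; apply: contraNneq dN => <-; apply: imset_f; rewrite inE.
apply: (IH (z |: C) (fun x => if x == z then d else f x)).
- apply: leq_trans le_m; apply: proper_card; apply/properP; split.
    by apply/subsetP => x; rewrite !inE negb_or => /andP[].
  by exists z => //; rewrite !inE eqxx.
- by move=> x; rewrite !inE; case: eqP => //= _; apply: fD.
- move=> x y; rewrite !inE.
  case: (eqVneq x z) => [->|xz] /=; case: (eqVneq y z) => [->|yz] //= xC yC.
  + by rewrite e_irr.
  + by move/dne; rewrite eq_sym.
  + by rewrite e_sym => /dne.
  + exact: fC.
- by move=> x; rewrite !inE negb_or => /andP[_ /degC].
Qed.

Lemma chromatic_le (G : sgraph) (D : {set G}) (g : G -> G) :
  (forall x, g x \in D) -> (forall x y, adj x y -> g x != g y) ->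
  chromatic_number G <= #|D|.
Proof.
move=> gD gP; rewrite /chromatic_number; case: ex_minnP => m _; apply.
apply/existsP; exists [ffun x => enum_rank_in (gD x) (g x)].
apply/forallP => x; apply/forallP => y; apply/implyP => xy; rewrite !ffunE.
apply: contraNneq (gP _ _ xy) => /(congr1 enum_val).
by rewrite !enum_rankK_in // => ->.
Qed.

(** With fewer than k vertices in [S], [delete S] would be connected, although its part inside [A]
    is closed under adjacency, contains [x] and misses [y]. *)
Lemma kconnected_separator k (G : sgraph) (A S : {set G}) x y :
  kconnected k G -> x \in A -> x \notin S -> y \notin A -> y \notin S ->
  (forall a b, a \in A -> a \notin S -> adj a b -> b \notin S -> b \in A) ->
  k <= #|S|.
Proof.
case=> _ kc xA xS yA yS cl; rewrite leqNgt; apply/negP => /kc.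
move/(_ (exist _ x xS) (exist _ y yS)) => con.
have clA : closed (@adj (delete S)) [pred u : delete S | val u \in A].
  apply: intro_closed; first exact: sym_connect_sym (@adj_sym _).
  move=> [a aS] [b bS]; rewrite /= /delete_rel !inE /= => ab aA.
  exact: cl ab bS.
have := closed_connect clA con; rewrite !inE /= xA.
by rewrite (negbTE yA).
Qed.

(** A neighbourhood of fewer than k vertices would leave some vertex that is neither [x] nor
    adjacent to it, as the order exceeds k, and would separate the two. *)
Lemma kconnected_deg k (G : sgraph) (x : G) :
  kconnected k G -> k <= deg (@adj G) x.
Proof.
move=> kc; rewrite leqNgt; apply/negP => lt.
have [y yN] : exists y, y \notin x |: [set y | adj x y].
  apply/existsP; rewrite -negb_forall; apply/negP => /forallP all.
  have : #|x |: [set y | adj x y]| = #|G| by apply: eq_card => y; rewrite all.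
  rewrite cardsU1 inE adj_irrefl /= -/(deg _ x) => eq.
  by case: kc; rewrite -eq ltnNge lt.
rewrite !inE negb_or in yN; case/andP: yN => yx nxy.
have := @kconnected_separator k G [set x] [set y | adj x y] x y kc.
rewrite !inE eqxx adj_irrefl yx nxy leqNgt lt /= => H.
suff : false by []; apply: H => // a b; rewrite !inE => /eqP -> _ ->.
by [].
Qed.

(** * Recognizing the exceptional graph *)

Lemma inj_ord (T : finType) (A : {set T}) m : #|A| = m -> A != set0 ->
  exists f : T -> 'I_m, {in A &, injective f}.
Proof.
move=> <- /set0Pn[x xA]; exists (enum_rank_in xA) => y z yA zA /(congr1 enum_val).
by rewrite !enum_rankK_in.
Qed.

(** [T] goes to the joined K_k, [L] to the independent K_k^c, and the remaining vertices [R] to the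
    last clique. [T] avoids [L], since a common vertex would be its own neighbour; hence [L] is
    independent. *)
Lemma split_graph_iso (G : sgraph) (L T : {set G}) k : 0 < k ->
  k.*2 < #|G| -> #|L| = k -> #|T| = k ->
  (forall l z, l \in L -> adj l z = (z \in T)) ->
  (forall x y, x \notin L -> y \notin L -> x != y -> adj x y) ->
  sgraph_iso G
     (join (complete k)
       (disjoint_union (complement (complete k)) (complete (#|G| - 2 * k)))).
Proof.
move=> k0 Gk cL cT adjL adjC.
have TL x : x \in T -> x \notin L.
  by move=> xT; apply/negP => xL; have := adjL x x xL; rewrite xT adj_irrefl.
pose R := ~: (L :|: T).
have cR : #|R| = #|G| - 2 * k.
  rewrite cardsCs setCK cardsU cL cT.
  have -> : L :&: T = set0.
    by apply/setP => x; rewrite !inE; case: (boolP (x \in T)) => [/TL/negbTE ->|]; rewrite ?andbF.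
  by rewrite cards0 subn0 mul2n addnn.
have [fT fTi] : exists f : G -> 'I_k, {in T &, injective f}.
  by apply: inj_ord => //; rewrite -card_gt0 cT.
have [fL fLi] : exists f : G -> 'I_k, {in L &, injective f}.
  by apply: inj_ord => //; rewrite -card_gt0 cL.
have [fR fRi] : exists f : G -> 'I_(#|G| - 2 * k), {in R &, injective f}.
  by apply: inj_ord => //; rewrite -card_gt0 cR subn_gt0 mul2n.
pose f x : 'I_k + ('I_k + 'I_(#|G| - 2 * k)) :=
  if x \in T then inl (fT x) else if x \in L then inr (inl (fL x)) else inr (inr (fR x)).
have f_inj : injective f.
  move=> x y; rewrite /f.
  case: (boolP (x \in T)) => xT; case: (boolP (y \in T)) => yT.
  - by case => /fTi ->.
  - by case: ifP.
  - by case: ifP.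
  case: (boolP (x \in L)) => xL; case: (boolP (y \in L)) => yL //.
  - by case => /fLi ->.
  - by case => /fRi -> //; rewrite !inE negb_or ?xT ?xL ?yT ?yL.
exists (f : G -> join (complete k)
       (disjoint_union (complement (complete k)) (complete (#|G| - 2 * k)))).
  apply: inj_card_bij f_inj _.
  by rewrite !card_sum !card_ord mul2n -addnn; move: Gk; rewrite -addnn; clear; lia.
have adjC' x y : x \notin L -> y \notin L -> adj x y = (x != y).
  move=> xL yL; case: eqVneq => [->|xy]; first exact: adj_irrefl.
  exact: adjC.
move=> x y; rewrite /f.
case: (boolP (x \in T)) => xT; case: (boolP (y \in T)) => yT.
- rewrite /= /complete_rel adjC' ?TL //; congr (~~ _).
  by apply/eqP/eqP => [/fTi ->|->].
- case: (boolP (y \in L)) => yL /=; first by rewrite adj_sym adjL ?xT.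
  by rewrite adjC' ?(TL x xT) //; case: (eqVneq x y) yT => // <-; rewrite xT.
- case: (boolP (x \in L)) => xL /=; first by rewrite adjL ?yT.
  by rewrite adjC' ?(TL y yT) //; case: (eqVneq x y) xT => // ->; rewrite yT.
case: (boolP (x \in L)) => xL; case: (boolP (y \in L)) => yL /=.
- rewrite adjL // (negbTE yT) /complement_rel /= /complete_rel negbK.
  by case: eqP.
- by rewrite adjL // (negbTE yT).
- by rewrite adj_sym adjL // (negbTE xT).
- rewrite /complete_rel adjC' //; congr (~~ _).
  by apply/eqP/eqP => [/fRi ->|->] //; rewrite !inE negb_or ?xT ?xL ?yT ?yL.
Qed.

(** * Degrees of nonadjacent vertices *)

Lemma subset_of_card (T : finType) (A : {set T}) m : m <= #|A| ->
  exists2 B : {set T}, B \subset A & #|B| = m.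
Proof.
case/card_geqP => s [Us sz sA]; exists [set x in s].
  by apply/subsetP => x; rewrite inE => /sA.
by rewrite cardsE (card_uniqP Us).
Qed.

Lemma complete_ham (V : finType) (e : rel V) : 2 < #|V| ->
  (forall x y, x != y -> e x y) -> ham e.
Proof.
move=> V_gt2 all_e; have sz := cardE V; have U := enum_uniq V.
have /card_gt0P[x0 _] : 0 < #|V| by apply: ltn_trans V_gt2.
apply: (@hamP _ e (enum V)) => //; rewrite (cycleE _ x0); last first.
  by rewrite -size_eq0 -sz -lt0n (ltn_trans _ V_gt2).
apply/andP; split.
  apply: pairwise_sorted; move: U; rewrite uniq_pairwise.
  by apply: sub_pairwise => x y /=; apply: all_e.
apply: all_e; move: sz U V_gt2; case: (enum V) => [|x [|y s]] /= -> //.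
by case/andP=> xs _ _; apply: contraNneq xs => <-; apply: mem_last.
Qed.

Lemma ore_nonadjacent (V : finType) (e : rel V) x y :
  symmetric e -> irreflexive e -> 2 < #|V| -> ~~ ham e ->
  (exists p, [/\ ham_path e p, head x p = x & last x p = y]) ->
  deg e x + deg e y <= #|V|.-1.
Proof.
move=> e_sym e_irr V_gt2 nh [p [hp px py]].
have := ore e_sym e_irr V_gt2 nh x hp; have /eqP sz : size p == #|V| by case/and3P: hp.
by rewrite nth0 px -sz nth_last py.
Qed.

(** Take a nonadjacent pair of maximal degree sum; one exists because complete graphs are
    Hamiltonian. Exchanging [u] for another non-neighbour of [v] cannot increase the sum. *)
Lemma max_deg_pair (V : finType) (e : rel V) :
  symmetric e -> 2 < #|V| -> ~~ ham e ->
  exists u v, [/\ u != v, ~~ e u v, deg e u <= deg e v &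
    forall l, l != v -> ~~ e v l -> deg e l <= deg e u].
Proof.
move=> e_sym V_gt2 nh; pose P q := (q.1 != q.2) && ~~ e q.1 q.2.
have [q0 Pq0] : exists q : V * V, P q.
  apply/existsP; apply: contraR nh; rewrite negb_exists => /forallP all.
  apply: complete_ham => // x y xy.
  by have := all (x, y); rewrite /P /= xy /= negbK.
case: (@arg_maxnP _ q0 P (fun q => deg e q.1 + deg e q.2) Pq0) => -[u v].
rewrite /P /= => /andP[uv nuv] max.
have [le|lt] := leqP (deg e u) (deg e v); [exists u, v | exists v, u].
  split => // l lv nvl; rewrite -(leq_add2r (deg e v)).
  by apply: (max (l, v)); rewrite /= lv e_sym.
split; rewrite 1?eq_sym 1?e_sym ?(ltnW lt) // => l lu nul.
rewrite -(leq_add2l (deg e u)).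
by apply: (max (u, l)); rewrite /= eq_sym lu.
Qed.

(** * The structure of G for n >= 2k + 2 and for n = 2k + 1 *)

Lemma split_large (k : nat) (G : sgraph) (e : rel G) (L : {set G}) (v : G) :
  0 < k -> kconnected k G -> #|G| - k <= chromatic_number G -> k.*2.+1 < #|G| ->
  subrel (@adj G) e ->
  (forall x y, x != y -> ~~ e x y -> deg e x + deg e y <= #|G|.-1) ->
  #|L| = k -> v \notin L -> {in L, forall l, ~~ adj v l} ->
  {in L, forall l, deg e l = k} ->
  exists T : {set G}, [/\ #|T| = k,
    forall l z, l \in L -> adj l z = (z \in T) &
    forall x y, x \notin L -> y \notin L -> x != y -> adj x y].
Proof.
move=> k0 kc chi Gk sub ore cL vL vadj degL.
have sube x : [set y | adj x y] \subset [set y | e x y].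
  by apply/subsetP => y; rewrite !inE; apply: sub.
have degle x : deg (@adj G) x <= deg e x by apply: subset_leq_card.
have cC : #|~: L| = #|G| - k by rewrite cardsCs setCK cL.
(* In G the degree of [l] is at least k, and in [e] it equals k, so the two neighbourhoods
   coincide. *)
have eL l z : l \in L -> adj l z = e l z.
  move=> lL; have := sube l => /subset_leqif_cards/geq_leqif.
  rewrite -/(deg e l) -/(deg _ l) degL // kconnected_deg // => /esym/eqP/setP/(_ z).
  by rewrite !inE.
have clique x y : x \notin L -> y \notin L -> x != y -> adj x y.
  move=> xL yL xy; apply/negPn/negP => nxy.
  (* Nonadjacent [x] and [y] can share a colour, leaving n - k - 1 colours; this still exceeds the
     degree k of the vertices of [L], as n >= 2k + 2. *)
  pose D := ~: L :\ y.
  have cD : #|D| = #|G| - k.+1.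
    by have := cardsD1 y (~: L); rewrite inE yL cC -/D; clear -Gk; lia.
  case: (@greedy_coloring _ (@adj G) (~: L) D (fun z => if z == y then x else z)).
  - exact: adj_sym.
  - exact: adj_irrefl.
  - move=> z; rewrite !inE; case: (eqVneq z y) => [_|zy]; first by rewrite xy xL.
    by rewrite zy.
  - move=> a b _ _; case: (eqVneq a y) => [->|ay]; case: (eqVneq b y) => [->|b_y] //.
    + by rewrite adj_irrefl.
    + by apply: contraTneq => <-; rewrite adj_sym.
    + by apply: contraTneq => ->.
    + by apply: contraTneq => ->; rewrite adj_irrefl.
  - move=> z; rewrite inE negbK => /degL zk; apply: leq_ltn_trans (degle z) _.
    by rewrite zk cD; clear -Gk; lia.
  move=> g gD gP; have := leq_trans chi (chromatic_le gD gP).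
  by rewrite cD; clear -Gk; lia.
pose T := [set c | (c \notin L) && [exists l in L, adj c l]].
have TP c l : c \in T -> l \in L -> adj l c.
  rewrite inE => /andP[cL1 /existsP[l0 /andP[l0L cl0]]] lL.
  rewrite eL // -[_ l c]negbK; apply/negP => nlc.
  have lc : l != c by apply: contraNneq cL1 => <-.
  have := ore _ _ lc nlc; rewrite degL // leqNgt => /negP; apply.
  have le : #|G| - k <= deg (@adj G) c.
    (* The neighbours of [c] include [l0] and the n - k - 1 other vertices outside [L]. *)
    have <- : #|l0 |: ~: L :\ c| = #|G| - k.
      by rewrite cardsU1 !inE l0L /= andbF /= -cC (cardsD1 c (~: L)) inE cL1.
    apply: subset_leq_card; apply/subsetP => z; rewrite !inE.
    case/orP=> [/eqP -> //|/andP[zc zL]]; by apply: clique; rewrite // eq_sym.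
  by have := leq_trans le (degle c); clear -Gk; lia.
have [l lL] : exists l, l \in L by apply/card_gt0P; rewrite cL.
have kT : k <= #|T|.
  apply: (@kconnected_separator k G L T l v) => //.
  - by rewrite inE lL.
  - rewrite inE vL /=; apply/negP => /existsP[l' /andP[l'L]].
    by apply/negP; apply: vadj.
  - move=> a b aL _ ab; rewrite inE negb_and negbK => /orP[//|/existsP[]].
    by exists a; rewrite aL adj_sym.
have NT l' : l' \in L -> T = [set z | adj l' z].
  move=> l'L; apply/eqP; rewrite eqEcard; apply/andP; split.
    by apply/subsetP => c cT; rewrite inE TP.
  by apply: leq_trans kT; rewrite -(degL _ l'L); apply: degle.
exists T; split => //; last by move=> l' z /NT ->; rewrite inE.
apply/eqP; rewrite eqn_leq kT andbT (NT l) // -(degL _ lL); exact: degle.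
Qed.

(** Only k vertices lie outside [S], so minimum degree k joins each vertex of [S] to all of them. *)
Lemma split_tight (k : nat) (G : sgraph) (S : {set G}) :
  0 < k -> kconnected k G -> #|G| - k <= chromatic_number G -> #|G| = k.*2.+1 ->
  #|S| = k.+1 -> {in S &, forall a b, ~~ adj a b} ->
  exists L T : {set G}, [/\ #|L| = k, #|T| = k,
    forall l z, l \in L -> adj l z = (z \in T) &
    forall x y, x \notin L -> y \notin L -> x != y -> adj x y].
Proof.
move=> k0 kc chi Gk cS indS.
have cW : #|~: S| = k by rewrite cardsCs setCK cS Gk subSS -addnn addnK.
have NS s z : s \in S -> adj s z = (z \notin S).
  move=> sS; suff /eqP/setP/(_ z) : [set z | adj s z] == ~: S by rewrite !inE.
  rewrite eqEcard cW kconnected_deg // andbT; apply/subsetP => y; rewrite !inE.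
  by apply: contraL => yS; apply: indS.
have [s0 s0S] : exists s, s \in S by apply/card_gt0P; rewrite cS.
have cliqueW x y : x \notin S -> y \notin S -> x != y -> adj x y.
  move=> xS yS xy; apply/negPn/negP => nxy.
  (* One colour [s0] for all of [S] and a common colour for [x] and [y] make k colours in total,
     fewer than n - k = k + 1. *)
  pose D := (s0 |: ~: S) :\ y.
  have cD : #|D| = k.
    have ys0 : y != s0 by apply: contraNneq yS => ->.
    have := cardsD1 y (s0 |: ~: S); rewrite -/D cardsU1 cW !inE s0S yS orbT /=.
    by clear; lia.
  pose g z := if z \in S then s0 else if z == y then x else z.
  have gD z : g z \in D.
    rewrite !inE /g; case: ifP => zS.
      by rewrite eqxx andbT; apply: contraNneq yS => <-.
    case: (eqVneq z y) => [_|zy]; first by rewrite xy xS orbT.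
    by rewrite zy zS orbT.
  suff gP a b : adj a b -> g a != g b.
    have := leq_trans chi (chromatic_le gD gP); rewrite cD Gk.
    by clear; lia.
  have gS c : c \notin S -> g c \notin S.
    by rewrite /g => /[dup] cS' /negbTE ->; case: ifP.
  case: (boolP (a \in S)) => aS; case: (boolP (b \in S)) => bS.
  - by rewrite (negbTE (indS _ _ aS bS)).
  - by move=> _; apply: contraNneq (gS _ bS) => <-; rewrite /g aS.
  - by move=> _; apply: contraNneq (gS _ aS) => ->; rewrite /g bS.
  rewrite /g (negbTE aS) (negbTE bS).
  case: (eqVneq a y) => [->|ay]; case: (eqVneq b y) => [->|b_y].
  + by rewrite adj_irrefl.
  + by apply: contraTneq => <-; rewrite adj_sym.
  + by apply: contraTneq => ->.
  + by apply: contraTneq => ->; rewrite adj_irrefl.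
(* Here n - 2k = 1, and [s0] serves as the single vertex of K_(n-2k). *)
exists (S :\ s0), (~: S); split => //.
- by have := cardsD1 s0 S; rewrite s0S cS => -[].
- by move=> l z; rewrite !inE => /andP[_ lS]; rewrite NS.
have split_notin x : x \notin S :\ s0 -> x = s0 \/ x \notin S.
  by rewrite !inE negb_and negbK => /orP[/eqP|]; [left|right].
move=> x y /split_notin[->|xS] /split_notin[->|yS] xy.
- by rewrite eqxx in xy.
- by rewrite NS.
- by rewrite adj_sym NS.
- exact: cliqueW.
Qed.

(** * Combining the two cases *)

Lemma chi_ham_or_split (k : nat) (G : sgraph) :
  1 < k -> kconnected k G -> #|G| - k <= chromatic_number G ->
  ham (@adj G) \/ k.*2 < #|G| /\
  exists L T : {set G}, [/\ #|L| = k, #|T| = k,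
    forall l z, l \in L -> adj l z = (z \in T) &
    forall x y, x \notin L -> y \notin L -> x != y -> adj x y].
Proof.
move=> k2 kc chi; have k0 : 0 < k := ltnW k2.
have kG : k < #|G| by case: kc.
have G_gt2 : 2 < #|G| := leq_ltn_trans k2 kG.
have [hG|nhG] := boolP (ham (@adj G)); [by left | right].
have [e [e_sym e_irr sub nh path_e]] :=
  maximal_nonham (@adj_sym G) (@adj_irrefl G) nhG.
have ore_e x y : x != y -> ~~ e x y -> deg e x + deg e y <= #|G|.-1.
  by move=> xy nxy; apply: ore_nonadjacent => //; apply: path_e.
have degle x : deg (@adj G) x <= deg e x.
  by apply: subset_leq_card; apply/subsetP => y; rewrite !inE; apply: sub.
have degk x : k <= deg e x := leq_trans (kconnected_deg x kc) (degle x).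
have [u [v [uv nuv le_uv maxu]]] := max_deg_pair e_sym G_gt2 nh.
have ore_uv := ore_e _ _ uv nuv.
pose N := [set l | (l != v) && ~~ e v l].
have cN : #|N| = #|G|.-1 - deg e v.
  have -> : N = ~: (v |: [set l | e v l]) by apply/setP => l; rewrite !inE negb_or.
  by rewrite cardsCs setCK cardsU1 inE e_irr -/(deg e v) /= add1n subnS -subn1 subnAC subn1.
(* By Ore's bound the n - 1 - d+(v) non-neighbours of [v] number at least d+(u). *)
have [L LN cL] : exists2 L : {set G}, L \subset N & #|L| = deg e u.
  by apply: subset_of_card; rewrite cN; move: ore_uv; clear; lia.
have LP l : l \in L -> [/\ l != v, ~~ e v l & deg e l <= deg e u].
  move=> /(subsetP LN); rewrite inE => /andP[lv nvl].
  by split => //; apply: maxu.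
have cC : #|~: L| = #|G| - deg e u by rewrite cardsCs setCK cL.
have hk : deg e u = k.
  apply/eqP; rewrite eqn_leq degk andbT.
  case: (@greedy_coloring _ (@adj G) (~: L) (~: L) id) => //.
  - exact: adj_sym.
  - exact: adj_irrefl.
  - by move=> x y _ _; apply: contraTneq => ->; rewrite adj_irrefl.
  - move=> z; rewrite inE negbK => /LP[_ _ zu].
    apply: leq_ltn_trans (leq_trans (degle z) zu) _.
    (* Twice d+(u) is at most d+(u) + d+(v) <= n - 1, so d+(u) < n - d+(u). *)
    by rewrite cC; move: ore_uv le_uv G_gt2; clear; lia.
  move=> g gD gP; have := leq_trans chi (chromatic_le gD gP).
  by rewrite cC; move: ore_uv le_uv kG G_gt2; clear; lia.
rewrite hk in cL ore_uv le_uv.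
have kkG : k.*2 < #|G| by move: ore_uv le_uv G_gt2; clear; lia.
split=> //; move: (kkG); rewrite leq_eqVlt => /orP[/eqP Gk|Gk].
  have Gk' := esym Gk.
  have [p [hp _ _]] := path_e _ _ uv nuv.
  case: (@indep_or_cutvertex _ e e_sym e_irr G_gt2 nh k u p) => //.
    case=> S0 cS0 indS0; have [S SS cS] := subset_of_card cS0.
    apply: (@split_tight k G S) => // a b /(subsetP SS) aS /(subsetP SS) bS.
    by apply: contra (indS0 _ _ aS bS); apply: sub.
  case=> A [c [x [y [xA yA xc yc cl]]]].
  (* Non-adjacency across the cut passes from [e] down to G, so [c] alone would separate G, against
     k >= 2. *)
  have : k <= #|[set c]|.
    apply: (@kconnected_separator k G A [set c] x y) => //; rewrite ?inE //.
    move=> a b aA; rewrite !inE => ac ab bc; exact: cl (sub _ _ ab) bc.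
  by rewrite cards1 leqNgt k2.
exists L; case: (@split_large k G e L v) => //.
- by apply/negP => /LP[]; rewrite eqxx.
- by move=> l /LP[_ nvl _]; apply: contra nvl; apply: sub.
- by move=> l /LP[_ _ lu]; apply/eqP; rewrite eqn_leq degk andbT -hk.
- by move=> T [? ? ?]; exists T.
Qed.

Theorem theorem1 (k : nat) (G : sgraph) (n : nat)
  (k_ge2 : 2 <= k)
  (G_kconn : kconnected k G)
  (G_order : #|G| = n)
  (chi_ge : n - k <= chromatic_number G) :
  hamiltonian G \/
  (2 * k + 1 <= n /\
   sgraph_iso G
     (join (complete k)
           (disjoint_union (complement (complete k)) (complete (n - 2 * k))))).
Proof.
move: chi_ge; rewrite -G_order => chi_ge.
case: (chi_ham_or_split k_ge2 G_kconn chi_ge) => [|[kG [L [T [cL cT LT clique]]]]].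
  case/andP=> G_gt2 /existsP[t Ct]; left; exists t; split.
  - by rewrite size_tuple.
  - exact: Ct.
  - by move=> x; rewrite (uniq_full (size_tuple t)) //; case/andP: Ct.
right; split; first by rewrite addn1 mul2n.
by apply: (@split_graph_iso G L T k) => //; apply: ltnW.
Qed.
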